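(* Let $S$ be a completely $0$-simple semigroup. Then $S$ is f-noetherian if and only if it is finitely generated (as a semigroup).
   Context: A right congruence on a semigroup $S$ is an equivalence relation $\rho$ on $S$ such that $(a,b)\in\rho$ implies $(as,bs)\in\rho$ for all $s\in S$. The right congruence generated by a set $X\subseteq S\times S$ is the smallest right congruence on $S$ containing $X$; a right congruence is finitely generated if it is generated by some finite set $X$. The index of an equivalence relation is the cardinality of its set of equivalence classes. A semigroup $S$ is f-noetherian if every right congruence of finite index on $S$ is finitely generated. A completely $0$-simple semigroup is a $0$-simple semigroup containing a primitive idempotent (equivalently, one isomorphic to a Rees matrix semigroup with zero $\mathcal{M}^0(G;I,J;P)$ over a group $G$, with $P=(p_{ji})$ a $J\times I$ matrix over $G\cup\{0\}$ having a non-zero entry in every row and every column). *)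

(* Defs.v *)
From mathcomp Require Import all_boot.
From mathcomp Require Import mathcomp_extra boolp classical_sets functions cardinality.

Set Implicit Arguments.
Unset Strict Implicit.
Unset Printing Implicit Defensive.

Local Open Scope classical_set_scope.
Local Open Scope group_scope.

Definition right_congruence (S : semigroupType) (rho : set (S * S)) : Prop :=
  RelationClasses.Equivalence (fun a b => rho (a, b)) /\
  (forall a b s : S, rho (a, b) -> rho (a * s, b * s)).

Definition right_congruence_generated (S : semigroupType) (X : set (S * S)) :
  set (S * S) := smallest (@right_congruence S) X.

Definition fg_right_congruence (S : semigroupType) (rho : set (S * S)) : Prop :=
  exists2 X : set (S * S), finite_set X & rho = right_congruence_generated X.

Definition finite_index (T : Type) (rho : set (T * T)) : Prop :=
  finite_set (range (fun a : T => [set b | rho (a, b)])).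

Definition f_noetherian (S : semigroupType) : Prop :=
  forall rho : set (S * S),
    right_congruence rho -> finite_index rho -> fg_right_congruence rho.

Definition subsemigroup (S : semigroupType) (A : set S) : Prop :=
  forall a b : S, A a -> A b -> A (a * b).

Definition fg_semigroup (S : semigroupType) : Prop :=
  exists2 X : set S, finite_set X & smallest (@subsemigroup S) X = setT.

Definition is_zero (S : semigroupType) (z : S) : Prop :=
  left_zero z (@mul S) /\ right_zero z (@mul S).

Definition ideal (S : semigroupType) (A : set S) : Prop :=
  A !=set0 /\ (forall a s : S, A a -> A (a * s) /\ A (s * a)).

Definition zero_simple (S : semigroupType) (z : S) : Prop :=
  [/\ is_zero z,
      [set a * b | a in [set: S] & b in [set: S]] <> [set z] &
      forall A : set S, ideal A -> A = [set z] \/ A = setT].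

(* Primitive: minimal among the nonzero idempotents for the natural order,
   where f <= e means e * f = f = f * e. *)
Definition primitive_idempotent (S : semigroupType) (z e : S) : Prop :=
  [/\ e * e = e, e <> z &
      forall f : S, f * f = f -> f <> z -> e * f = f -> f * e = f -> f = e].

(* The zero of a semigroup is unique when it exists, so quantifying over it
   existentially involves no choice. *)
Definition completely_zero_simple (S : semigroupType) : Prop :=
  exists z : S, zero_simple z /\ exists e : S, primitive_idempotent z e.

(* Main.v *)
Require Import Defs.
From mathcomp Require Import all_boot.
From mathcomp Require Import boolp classical_sets cardinality.

(** One implication holds in every semigroup, by Schreier's argument: if [A]
    generates [S] and [R] is a finite transversal of a right congruence of
    finite index, then the pairs rewriting elements of [A], of [R * A] and of
    [R] to representatives in [R] generate the congruence, because a word can be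
    reduced letter by letter (lemma [fg_semigroup_f_noetherian]).

    For the converse, suppose [S] is completely 0-simple and f-noetherian, and
    apply the hypothesis to two right congruences.

    - The universal congruence has index one. It can only be finitely generated
      if [S] is a finitely generated right ideal of itself, [S = F S^1] with [F]
      finite ([f_noetherian_right_ideal_generators]); in Rees coordinates this
      says that the number of R-classes is finite.
    - The relation identifying [a] and [b] when they have the same right
      annihilator is a right congruence. As [S = F S^1], the annihilator of [a]
      is determined by the subset of [F] killed by [a], so the index is finite.

    Complete 0-simplicity enters through left stability: if [s * a] is nonzero
    then [a] can be recovered from it by a left multiplication
    ([completely_zero_simple_left_stable]). Let a finite set [X] generate the
    annihilator congruence. An elementary step of a derivation from [X] passes
    from [x * s] to [y * s] with [(x, y)] in [X]. If [x * s] is nonzero and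
    [s = f * v] with [f] in [F], then left stability gives [w] with
    [f = w * (x * f)], so [y * s = (y * w) * (x * s)]; thus the step is left
    multiplication by [y * w], one of finitely many elements since [w] depends
    only on [x] and [f]. Adding these elements to a transversal and to the
    components of [X] gives a finite generating set of [S]
    ([left_stable_fg_semigroup]). *)

Set Implicit Arguments.
Unset Strict Implicit.
Unset Printing Implicit Defensive.

Local Open Scope classical_set_scope.
Local Open Scope group_scope.

(** * Equivalences of finite index *)

Lemma finite_index_transversal (T : choiceType) (rho : set (T * T)) :
  RelationClasses.Equivalence (fun a b => rho (a, b)) -> finite_index rho ->
  exists2 R : set T, finite_set R & forall a, exists2 r, R r & rho (a, r).
Proof.
move=> [rho_refl _ _] fin_rho.
have [[a0]|noT] := pselect (inhabited T); last first.
  by exists set0 => // a; case: noT; exists.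
exists (xget a0 @` range (fun a => [set b | rho (a, b)])).
  exact: finite_image.
move=> a; exists (xget a0 [set b | rho (a, b)]).
  by exists [set b | rho (a, b)] => //; exists a.
exact: (xgetI a0 (rho_refl a)).
Qed.

Lemma finite_index_kernel (T : Type) (K : finType) (k : T -> K)
    (rho : set (T * T)) :
  (forall a b c, k a = k b -> rho (a, c) -> rho (b, c)) -> finite_index rho.
Proof.
move=> krho; pose class_of_key q := [set b | exists2 a, k a = q & rho (a, b)].
apply: (@sub_finite_set _ _ (class_of_key @` setT)); last first.
  exact/finite_image/finite_finset.
move=> _ [a _ <-]; exists (k a) => //.
apply/seteqP; split=> b /=; last by exists a.
by case=> c kca; apply: krho.
Qed.

(** * Right congruences generated by a set *)

Lemma right_congruence_generatedP (S : semigroupType) (X : set (S * S)) :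
  right_congruence (right_congruence_generated X).
Proof.
split; first split.
- by move=> a rho [[[rho_refl _ _] _] _]; apply: rho_refl.
- move=> a b ab rho rhoP; have [[[_ rho_sym _] _] _] := rhoP.
  exact: rho_sym (ab _ rhoP).
- move=> a b c ab bc rho rhoP; have [[[_ _ rho_trans] _] _] := rhoP.
  exact: (rho_trans _ b _ (ab _ rhoP) (bc _ rhoP)).
- move=> a b s ab rho rhoP; have [[_ rhoM] _] := rhoP.
  exact: rhoM (ab _ rhoP).
Qed.

Theorem fg_semigroup_f_noetherian (S : semigroupType) :
  fg_semigroup S -> f_noetherian S.
Proof.
move=> [A finA genA] rho rhoP fin_rho.
have [[_ rho_sym rho_trans] rhoM] := rhoP.
have [R finR trR] := finite_index_transversal rhoP.1 fin_rho.
pose RA := (fun p => p.1 * p.2) @` (R `*` A).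
pose X := ((A `|` RA `|` R) `*` R) `&` rho.
exists X.
  apply: finite_setIl; apply: finite_setX => //.
  rewrite !finite_setU; split=> //; split=> //.
  exact/finite_image/finite_setX.
set tau := right_congruence_generated X.
have [[tau_refl tau_sym tau_trans] tauM] : right_congruence tau.
  exact: right_congruence_generatedP.
have X_tau : X `<=` tau by apply: sub_gen_smallest.
apply/seteqP; split; last by apply: smallest_sub => // p [].
have reduce a : (A `|` RA `|` R) a -> exists2 r, R r & tau (a, r).
  have [r Rr rho_ar] := trR a; exists r => //.
  by apply: X_tau; split.
(* Besides [a] itself, the products [r * a] must reduce: this makes the property
   stable under arbitrary products, not only under appending a generator. *)
pose B := [set a | (exists2 r, R r & tau (a, r)) /\
                   forall r, R r -> exists2 r', R r' & tau (r * a, r')].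
have BT a : B a.
  suff : smallest (@subsemigroup S) A `<=` B by apply; rewrite genA.
  apply: smallest_sub => [b c [[r Rr br] bR] [[r1 _ _] cR]|b Ab].
    split.
      have [r' Rr' rcr'] := cR _ Rr; exists r' => //.
      exact: tau_trans (tauM _ _ c br) rcr'.
    move=> r2 /bR[r3 /cR[r4 Rr4 r3c] r2b]; exists r4 => //.
    by rewrite mulgA; apply: tau_trans (tauM _ _ c r2b) r3c.
  split; first by apply: reduce; left; left.
  by move=> r Rr; apply: reduce; left; right; exists (r, b).
move=> [a b] rho_ab.
have [[r Rr ar] _] := BT a; have [[r' Rr' br'] _] := BT b.
have tau_rho : tau `<=` rho by apply: smallest_sub => // p [].
apply: (tau_trans _ r _ ar); apply: (tau_trans _ r'); last exact: tau_sym.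
apply: X_tau; split; first by split=> /=; [right|].
apply: (rho_trans _ a); first exact: (rho_sym _ _ (tau_rho _ ar)).
exact: (rho_trans _ b _ rho_ab (tau_rho _ br')).
Qed.

(** The components of a generating set of the universal congruence generate [S]
    as a right ideal: for a right ideal [K], identifying the elements of [K]
    with each other and nothing else is a right congruence. Adding [p] to the
    generators covers the one element that this congruence may relate to [p]
    by equality alone. *)
Lemma f_noetherian_right_ideal_generators (S : semigroupType) (p : S) :
  f_noetherian S ->
  exists2 F : set S, finite_set F &
    forall a, F a \/ exists2 f, F f & exists v, a = f * v.
Proof.
move=> noethS.
have [||X finX genX] := noethS setT.
- by split=> //; split.
- apply: (@finite_index_kernel _ unit (fun=> tt)) => //.
pose F := fst @` X `|` snd @` X `|` [set p].
exists F.
  by rewrite !finite_setU; do !split; try exact: finite_image.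
pose K := [set a | F a \/ exists2 f, F f & exists v, a = f * v].
have KM a s : K a -> K (a * s).
  case=> [Fa|[f Ff [v ->]]]; right; first by exists a => //; exists s.
  by exists f => //; exists (v * s); rewrite mulgA.
pose sigma := [set q : S * S | q.1 = q.2 \/ K q.1 /\ K q.2].
have X_sigma : right_congruence_generated X `<=` sigma.
  apply: smallest_sub => [|q Xq]; last first.
    by right; split; left; left; [left|right]; exists q.
  split; first split => [a|a b|a b c]; rewrite /sigma /=.
  - by left.
  - by case=> [<-|[]]; [left|right].
  - by case=> [->//|[Ka Kb]] [<-|[_ Kc]]; right.
  - by move=> a b s [->|[Ka Kb]]; [left|right; split; apply: KM].
move=> a; have : sigma (a, p) by apply: X_sigma; rewrite -genX.
by case=> [/= ->|[]//]; left; right.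
Qed.

(** * Left stability *)

(** Every nonzero left multiple of [a] generates the same left ideal as [a]. *)
Definition left_stable (S : semigroupType) (z : S) : Prop :=
  forall s a : S, s * a <> z -> exists w, a = w * (s * a).

Lemma zero_simple_factor (S : semigroupType) (z b a : S) :
  zero_simple z -> b <> z -> exists u v, a = u * b * v.
Proof.
move=> [[z0 zr] SSz simpleS] bz.
pose I (c : S) := [set a | exists u v, a = u * c * v].
have idealI c : ideal (I c).
  split; first by exists (c * c * c), c, c.
  move=> _ s [u [v ->]]; split; first by exists u, (v * s); rewrite mulgA.
  by exists (s * u), v; rewrite !mulgA.
suff: I b = setT by move=> IT; have: I b a by rewrite IT.
have [Ib|//] := simpleS _ (idealI b).
(* The elements [c] with [S c S = 0] form an ideal; if it were all of [S], then
   [S S S = 0], whereas [S S] is a nonzero ideal and so equals [S]. *)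
have Nall c u v : u * c * v = z.
  pose N := [set c : S | forall u v, u * c * v = z].
  have idealN : ideal N.
    split; first by exists z => u' v'; rewrite zr z0.
    move=> d s Nd; split=> u' v'.
      by rewrite -(Nd u' (s * v')) !mulgA.
    by rewrite -(Nd (u' * s) v') !mulgA.
  have Nb : N b.
    move=> u' v'; have : I b (u' * b * v') by exists u', v'.
    by rewrite Ib.
  have [Nz|NT] := simpleS _ idealN; first by move: Nb; rewrite Nz => /bz.
  by have : N c by rewrite NT.
have idealSS : ideal [set x * y | x in [set: S] & y in [set: S]].
  split; first by exists (b * b), b => //; exists b.
  move=> _ s [x _ [y _ <-]]; split; first by exists (x * y) => //; exists s.
  by exists s => //; exists (x * y).
have [/SSz//|SST] := simpleS _ idealSS.
case: SSz; apply/seteqP; split=> [_ [x _ [y _ <-]]|_ ->]; last first.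
  by exists z => //; exists z => //; rewrite z0.
have : [set x * y | x in [set: S] & y in [set: S]] x by rewrite SST.
by case=> x1 _ [x2 _ <-]; rewrite Nall.
Qed.

(** The left ideal of a primitive idempotent [e] is 0-minimal. From
    [e = p * b * q] with [e * p = p] and [e * q = q] one gets the nonzero idempotent
    [q * p * b] below [e], which by primitivity is [e]. *)
Lemma primitive_idempotent_minimal (S : semigroupType) (z e b : S) :
  zero_simple z -> primitive_idempotent z e -> b <> z -> b * e = b ->
  exists t, e = t * b.
Proof.
move=> zsS [ee ez prim] bz be.
have [[z0 zr] _ _] := zsS.
have [u [v euv]] := zero_simple_factor e zsS bz.
have [p [q [epq ep eq]]] :
    exists p q, [/\ p * b * q = e, e * p = p & e * q = q].
  exists (e * u), (e * v * e); split; rewrite ?mulgA ?ee //.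
  by rewrite -(mulgA _ b e) be -(mulgA e u) -(mulgA e) -euv !ee.
exists (q * p); symmetry; apply: prim.
- have -> : q * p * b * (q * p * b) = q * (e * p) * b by rewrite -epq !mulgA.
  by rewrite ep.
- move=> qpb; apply: ez.
  have -> : e = p * b * (q * p * b) * q by rewrite -{1}ee -epq !mulgA.
  by rewrite qpb zr z0.
- by rewrite !mulgA eq.
- by rewrite -!mulgA be.
Qed.

Lemma completely_zero_simple_left_stable (S : semigroupType) (z e : S) :
  zero_simple z -> primitive_idempotent z e -> left_stable z.
Proof.
move=> zsS prime s a saz; have [ee ez _] := prime.
have [[z0 zr] _ _] := zsS.
have [u [v auv]] := zero_simple_factor a zsS ez.
have [||t et] := @primitive_idempotent_minimal _ z e (s * u * e) zsS prime.
- by move=> suez; apply: saz; rewrite auv !mulgA suez z0.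
- by rewrite -mulgA ee.
exists (u * t); rewrite {1}auv {1}et {1}auv.
by rewrite !mulgA.
Qed.

(** * From f-noetherian to finitely generated *)

Definition annihilator_congruence (S : semigroupType) (z : S) : set (S * S) :=
  [set p | forall s, p.1 * s = z <-> p.2 * s = z].

Lemma annihilator_congruenceP (S : semigroupType) (z : S) :
  right_congruence (annihilator_congruence z).
Proof.
split; first split.
- by [].
- by move=> a b ab s; split=> /ab.
- by move=> a b c ab bc s; split=> [/ab/bc|/bc/ab].
- by move=> a b s ab t; rewrite /= -!mulgA; apply: ab.
Qed.

(** When [a * f] and [f * v] are nonzero so is [a * (f * v)], by left
    stability; hence [a] annihilates a nonzero [f * v] exactly when it
    annihilates [f], and the elements of [F] decide everything. *)
Lemma annihilator_congruence_finite_index (S : semigroupType) (z : S)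
    (F : set S) :
  is_zero z -> left_stable z -> finite_set F ->
  (forall a, F a \/ exists2 f, F f & exists v, a = f * v) ->
  finite_index (annihilator_congruence z).
Proof.
move=> [z0 zr] stabS /finite_seqP[l ->] Fgen.
pose k (a : S) := [tuple of map (fun f => a * f == z) (in_tuple l)].
apply: (@finite_index_kernel _ _ k) => a b c kab ac s.
suff ab : a * s = z <-> b * s = z.
  by split=> [/ab/ac|/ac/ab].
have abl f : f \in l -> a * f = z <-> b * f = z.
  move=> lf; have /eq_in_map/(_ f lf) : map (fun f => a * f == z) l =
    map (fun f => b * f == z) l by exact: (congr1 val kab).
  by move=> abf; split=> /eqP; [rewrite abf|rewrite -abf] => /eqP.
have [/abl//|[f /abl abf [v ->]]] := Fgen s.
have [->|/eqP fvz] := eqVneq (f * v) z; first by rewrite !zr.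
have fvE d : d * (f * v) = z <-> d * f = z.
  split=> [dfv|df]; last by rewrite mulgA df z0.
  apply: contrapT => /stabS[w fw]; apply: fvz.
  by rewrite fw -!mulgA dfv zr.
by split=> /fvE/abf/fvE.
Qed.

Theorem left_stable_fg_semigroup (S : semigroupType) (z : S) :
  is_zero z -> left_stable z -> f_noetherian S -> fg_semigroup S.
Proof.
move=> zP stabS noethS; have [z0 zr] := zP.
have [F finF Fgen] := f_noetherian_right_ideal_generators z noethS.
have rhoP := annihilator_congruenceP z.
have fin_rho := annihilator_congruence_finite_index zP stabS finF Fgen.
have [R finR trR] := finite_index_transversal rhoP.1 fin_rho.
have [X finX genX] := noethS _ rhoP fin_rho.
have /choice[w wP] : forall q : S * S, exists w,
    q.1 * q.2 <> z -> q.2 = w * (q.1 * q.2).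
  move=> q; have [qz|/stabS[w qw]] := pselect (q.1 * q.2 = z); first by exists z.
  by exists w.
pose C := fst @` X `|` snd @` X.
have finC : finite_set C by rewrite finite_setU; split; apply: finite_image.
pose W := (fun q => q.1 * w q.2) @` (C `*` (C `*` F)).
pose A := [set z] `|` R `|` C `|` W.
exists A.
  by rewrite !finite_setU; do !split=> //; apply: finite_image => //;
     apply: finite_setX => //; apply: finite_setX.
set T := smallest (@subsemigroup S) A.
have AT : A `<=` T by apply: sub_gen_smallest.
have TM a b : T a -> T b -> T (a * b).
  by move=> Ta Tb B BP; exact: (BP.1 _ _ (Ta _ BP) (Tb _ BP)).
have Tz : T z by apply: AT; left; left; left.
have step x y s : C x -> C y -> annihilator_congruence z (x, y) ->
    T (x * s) -> T (y * s).
  move=> Cx Cy xy Txs.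
  have [/xy/= ->//|xsz] := pselect (x * s = z).
  suff [t At ->] : exists2 t, A t & y * s = t * (x * s) by apply: TM => //; apply: AT.
  have [Fs|[f Ff [v sfv]]] := Fgen s.
    exists (y * w (x, s)); first by right; exists (y, (x, s)).
    by rewrite -mulgA -(wP (x, s)).
  exists (y * w (x, f)); first by right; exists (y, (x, f)).
  have fw : f = w (x, f) * (x * f).
    by apply: (wP (x, f)) => /= xf; apply: xsz; rewrite sfv mulgA xf z0.
  by rewrite sfv [in LHS]fw -!mulgA.
(* [theta] is the largest right congruence of which [T] is a union of classes. *)
pose theta := [set p : S * S | (T p.1 <-> T p.2) /\
                               forall s, T (p.1 * s) <-> T (p.2 * s)].
have rho_theta : annihilator_congruence z `<=` theta.
  rewrite {1}genX; apply: smallest_sub.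
    split; first split.
    - by [].
    - by move=> a b [ab abs]; split=> [|s]; apply: iff_sym.
    - move=> a b c [ab abs] [bc bcs]; split=> [|s]; first exact: iff_trans ab bc.
      exact: iff_trans (abs s) (bcs s).
    - by move=> a b s [_ abs]; split=> [|t]; rewrite /= -?mulgA; apply: abs.
  move=> [x y] Xxy.
  have Cx : C x by left; exists (x, y).
  have Cy : C y by right; exists (x, y).
  have xy : annihilator_congruence z (x, y).
    by rewrite genX; apply: sub_gen_smallest Xxy.
  have CT : C `<=` T by move=> c Cc; apply: AT; left; right.
  split=> [|s]; first by split=> _; apply: CT.
  by split; apply: step => // t; apply: iff_sym.
apply/seteqP; split=> // a _.
have [r Rr /rho_theta[ar _]] := trR a.
by apply/ar; apply: AT; left; left; right.
Qed.

Theorem theorem7p5 (S : semigroupType) (hS : completely_zero_simple S) :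
  f_noetherian S <-> fg_semigroup S.
Proof.
split; last exact: fg_semigroup_f_noetherian.
have [z [zsS [e prime]]] := hS; have [zP _ _] := zsS.
exact: left_stable_fg_semigroup zP (completely_zero_simple_left_stable zsS prime).
Qed.
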